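(* Let $p_+,p_-$ be probability densities on $\mathcal{X}\subseteq\mathbb{R}^d$ with $p_->0$ on $\mathcal{X}$, and let $\mathrm{ROC}^*$ be the optimal ROC curve. Then $$\mathrm{arc}(\mathrm{ROC}^* )=\sup_{v}\ \Big\{\mathbb{E}_{p_+}\big[\sin v(x)\big]+\mathbb{E}_{p_-}\big[\cos v(x)\big]\Big\},$$ where the supremum is over all measurable functions $v:\mathcal{X}\to[0,\pi/2]$, and the supremum is attained at $v^*(x)=\arctan\frac{p_+(x)}{p_-(x)}$.
   Context: $\mathbb{P}_+$ and $\mathbb{P}_-$ are distributions on $\mathcal{X}\subseteq\mathbb{R}^d$ with densities $p_+$ and $p_-$. For a measurable score function $t:\mathcal{X}\to\mathbb{R}$, $F_+$ and $F_-$ are the CDFs of $t(x^+)$ and $t(x^-)$ with $x^+\sim\mathbb{P}_+$, $x^-\sim\mathbb{P}_-$. Standing assumptions on score functions: $F_+$ and $F_-$ are strictly increasing on the interval of score values and have densities $f_+,f_-$ (with $f_->0$ on that interval; both vanish outside it). With $\tilde F_\pm=1-F_\pm$, the ROC curve $\mathrm{ROC}(t)$ is the graph of $s\mapsto\tilde F_+(\tilde F_-^{-1}(s))$, $s\in[0,1]$, parameterized by $\tau\mapsto(\tilde F_-(\tau),\tilde F_+(\tau))$; its arc length is $$\mathrm{arc}(\mathrm{ROC}(t))=\int_{-\infty}^{\infty}\sqrt{f_+(\tau)^2+f_-(\tau)^2}\,\mathrm{d}\tau .$$ An optimal score is $t^*(x)=\gamma\!\left(\frac{p_+(x)}{p_-(x)}\right)$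 with $\gamma$ strictly increasing, and $\mathrm{ROC}^*=\mathrm{ROC}(t^* )$ (the curve does not depend on $\gamma$). The standing assumptions are assumed for optimal scores. *)

(* Defs.v *)
From HB Require Import structures.
From mathcomp Require Import all_boot all_order all_algebra.
From mathcomp Require Import all_classical all_reals all_analysis.

Set Implicit Arguments.
Unset Strict Implicit.
Unset Printing Implicit Defensive.
Import Order.TTheory GRing.Theory Num.Theory.
Import numFieldNormedType.Exports.

Local Open Scope classical_set_scope.
Local Open Scope ring_scope.

Lemma sigma_finite_measure_ex d (T : measurableType d) (R : realType)
    (nu : set T -> \bar R) :
  nu set0 = 0%E -> (forall A, 0 <= nu A)%E -> semi_sigma_additive nu ->
  sigma_finite setT nu ->
  exists m : {sigma_finite_measure set T -> \bar R}, nu = m.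
Proof.
move=> nu0 nuge0 nusa nusf.
pose M := isMeasure.Build _ _ _ nu nu0 nuge0 nusa.
pose nuM : {measure set T -> \bar R} := HB.pack nu M.
pose S := Measure_isSigmaFinite.Build _ _ _ nuM nusf.
pose nuS : {sigma_finite_measure set T -> \bar R} := HB.pack nu M S.
by exists nuS.
Qed.

Section pushforward_product.
Local Open Scope ereal_scope.
Context d1 d2 d3 (T1 : measurableType d1) (T2 : measurableType d2)
  (T3 : measurableType d3) (R : realType).
Variables (m1 : {sigma_finite_measure set T1 -> \bar R})
  (m2 : {sigma_finite_measure set T2 -> \bar R}).

Lemma pushforward_product_sigma_finite (f : T1 * T2 -> T3) (g : T3 -> T1 * T2) :
  measurable_fun setT f -> measurable_fun setT g -> cancel f g ->
  exists nu : {sigma_finite_measure set T3 -> \bar R},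
    pushforward (m1 \x m2) f = nu.
Proof.
move=> mf mg fK; pose nu := pushforward (m1 \x m2) f.
have muA A : measurable A -> measurable (f @^-1` A).
  by move=> mA; rewrite -[X in measurable X]setTI; exact: mf.
have nu0 : nu set0 = 0 by rewrite /nu /pushforward preimage_set0 measure0.
have nuge0 A : 0 <= nu A by rewrite /nu /pushforward measure_ge0.
have nusa : semi_sigma_additive nu.
  move=> F mF tF mUF; rewrite /nu /pushforward preimage_bigcup.
  apply: measure_semi_sigma_additive.
  - by move=> n; exact: muA.
  - apply/trivIsetP => /= i j _ _ ij; rewrite -preimage_setI.
    by move/trivIsetP : tF => /(_ _ _ _ _ ij) ->//; rewrite preimage_set0.
  - by rewrite -preimage_bigcup; exact: muA.
have nusf : sigma_finite setT nu.
  have /sigma_finiteP[F [TF ndF Foo]] := sigma_finiteT m1.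
  have /sigma_finiteP[G [TG ndG Goo]] := sigma_finiteT m2.
  exists (fun n => g @^-1` (F n `*` G n)).
    rewrite -preimage_bigcup; apply/seteqP; split => // z _ /=.
    have [n _ Fn] : (\bigcup_i F i) (g z).1 by rewrite -TF.
    have [k _ Gk] : (\bigcup_i G i) (g z).2 by rewrite -TG.
    exists (maxn n k) => //; split.
    - by move: Fn; exact/subsetPset/ndF/leq_maxl.
    - by move: Gk; exact/subsetPset/ndG/leq_maxr.
  move=> n; have [mF Fy] := Foo n; have [mG Gy] := Goo n; split.
    by rewrite -[X in measurable X]setTI; apply: mg => //; exact: measurableX.
  rewrite /nu /pushforward -comp_preimage (_ : _ \o _ = id); last first.
    by apply/funext => z /=; rewrite fK.
  by rewrite preimage_id product_measure1E// lte_mul_pinfty// ge0_fin_numE.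
exact: sigma_finite_measure_ex.
Qed.

End pushforward_product.

(* R^d, with the product of the Borel sigma-algebras of its d coordinates. *)
Notation euclid R d := (d.-tuple (measurableTypeR R)).

Section lebesgue_euclid.
Variable R : realType.
Local Open Scope ereal_scope.

Definition euclid_cons d (z : measurableTypeR R * euclid R d) : euclid R d.+1 :=
  [tuple of z.1 :: z.2].

(* d-dimensional Lebesgue measure: the d-fold product of [lebesgue_measure],
   transported along R * R^d -> R^(d+1); on R^0 it is the unit point mass. *)
Fixpoint lebesgue_euclid (d : nat) : set (euclid R d) -> \bar R :=
  match d with
  | 0 => \d_([tuple] : euclid R 0)
  | d'.+1 => pushforward
      (@lebesgue_measure R \x @lebesgue_euclid d') (@euclid_cons d')
  end.
Arguments lebesgue_euclid : clear implicits.

Lemma measurable_euclid_cons d : measurable_fun setT (@euclid_cons d).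
Proof. exact: measurable_cons. Qed.

Definition euclid_uncons d (t : euclid R d.+1) :
  measurableTypeR R * euclid R d := (thead t, [tuple of behead t]).

Lemma euclid_unconsK d : cancel (@euclid_uncons d) (@euclid_cons d).
Proof. by move=> t; rewrite /euclid_cons /= -tuple_eta. Qed.

Lemma euclid_consK d : cancel (@euclid_cons d) (@euclid_uncons d).
Proof. by move=> [a b]; congr pair; apply/val_inj. Qed.

Lemma measurable_euclid_uncons d : measurable_fun setT (@euclid_uncons d).
Proof.
by apply: measurable_fun_pair; [exact: measurable_tnth|exact: measurable_behead].
Qed.

Let lebesgue_euclidP d :
  exists m : {sigma_finite_measure set (euclid R d) -> \bar R},
    lebesgue_euclid d = m.
Proof.
elim: d => [|d [m IH]]; first by exists (dirac ([tuple] : euclid R 0)).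
have [nu nuE] := pushforward_product_sigma_finite lebesgue_measure m
  (@measurable_euclid_cons d) (@measurable_euclid_uncons d) (@euclid_consK d).
by exists nu; rewrite -nuE /= IH.
Qed.

Let lebesgue_euclid0 d : lebesgue_euclid d set0 = 0.
Proof. by have [m ->] := lebesgue_euclidP d; rewrite measure0. Qed.

Let lebesgue_euclid_ge0 d A : 0 <= lebesgue_euclid d A.
Proof. by have [m ->] := lebesgue_euclidP d; exact: measure_ge0. Qed.

Let lebesgue_euclid_sigma_additive d : semi_sigma_additive (lebesgue_euclid d).
Proof.
by have [m ->] := lebesgue_euclidP d; exact: measure_semi_sigma_additive.
Qed.

HB.instance Definition _ d := isMeasure.Build _ _ _ (lebesgue_euclid d)
  (@lebesgue_euclid0 d) (@lebesgue_euclid_ge0 d)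
  (@lebesgue_euclid_sigma_additive d).

Let lebesgue_euclid_sigma_finite d : sigma_finite setT (lebesgue_euclid d).
Proof. by have [m ->] := lebesgue_euclidP d; exact: sigma_finiteT. Qed.

HB.instance Definition _ d := Measure_isSigmaFinite.Build _ _ _
  (lebesgue_euclid d) (@lebesgue_euclid_sigma_finite d).

Lemma lebesgue_euclid_box d (A : 'I_d -> set (measurableTypeR R)) :
  (forall i, measurable (A i)) ->
  lebesgue_euclid d [set x | forall i, A i (tnth x i)] =
  \prod_(i < d) lebesgue_measure (A i).
Proof.
elim: d A => [|d IH] A mA.
  rewrite big_ord0 /= diracE mem_set//.
  by case.
rewrite big_ord_recl -IH; last by move=> i; exact: mA.
rewrite -(product_measure1E lebesgue_measure (lebesgue_euclid d))//; last first.
  rewrite (_ : mkset _ =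
      \bigcap_(i in [set: 'I_d]) (@tnth d _ ^~ i @^-1` A (lift ord0 i))).
    apply: fin_bigcap_measurable => // i _.
    by rewrite -[X in measurable X]setTI; exact: measurable_tnth.
  by apply/seteqP; split => [x Ax i _|x Ax i]; [exact: Ax|exact: Ax].
rewrite /= /pushforward; congr product_measure1.
apply/seteqP; split => [[a x] /= h|[a x] /= [h0 h] i].
  by split=> [|i]; [exact: h ord0|have := h (lift ord0 i); rewrite tnthS].
by case: (unliftP ord0 i) => [j ->|->]; [rewrite tnthS|].
Qed.

End lebesgue_euclid.
Arguments lebesgue_euclid {R} d.

Section roc.
Context {R : realType} {d : nat}.
Implicit Types (X : set (euclid R d)) (P : probability (euclid R d) R)
  (p t v : euclid R d -> R) (f : R -> R).

(* Functions on X are represented by total functions on R^d whose values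
   outside X are never used. *)

Definition has_density X P p : Prop :=
  [/\ measurable_fun X p,
      forall x, X x -> 0 <= p x
    & forall A, measurable A ->
        P A = (\int[lebesgue_euclid d]_(x in X `&` A) (p x)%:E)%E].

Definition score_cdf X P t (s : R) : \bar R := P (X `&` [set x | t x <= s]).

Definition has_cdf_density (F : R -> \bar R) f : Prop :=
  [/\ measurable_fun setT f,
      forall s, 0 <= f s
    & forall s, F s = (\int[lebesgue_measure]_(u in `]-oo, s]) (f u)%:E)%E].

(* [J] is the interval of score values. *)
Record regular_score X (Pp Pm : probability (euclid R d) R) t (J : set R)
    (fp fm : R -> R) : Prop := RegularScore {
  score_measurable : measurable_fun X t ;
  score_itv : is_interval J ;
  score_in : t @` X `<=` J ;
  score_cdfp_inc :
    {in J &, {homo score_cdf X Pp t : x y / x < y >-> (x < y)%E}} ;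
  score_cdfm_inc :
    {in J &, {homo score_cdf X Pm t : x y / x < y >-> (x < y)%E}} ;
  score_densp : has_cdf_density (score_cdf X Pp t) fp ;
  score_densm : has_cdf_density (score_cdf X Pm t) fm ;
  score_densm_gt0 : forall s, J s -> 0 < fm s ;
  score_dens_out : forall s, ~ J s -> fp s = 0 /\ fm s = 0
}.

(* The ROC curve s |-> (1 - F_-(s), 1 - F_+(s)) has velocity (- fm, - fp). *)
Definition roc_arc_length (fp fm : R -> R) : \bar R :=
  (\int[lebesgue_measure]_s (Num.sqrt (fp s ^+ 2 + fm s ^+ 2))%:E)%E.

Definition optimal_score (gamma : R -> R) (pp pm : euclid R d -> R) :=
  fun x => gamma (pp x / pm x).

Definition angle_function X v : Prop :=
  measurable_fun X v /\ forall x, X x -> 0 <= v x <= pi / 2.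

Definition angle_objective X (Pp Pm : probability (euclid R d) R) v : \bar R :=
  (\int[Pp]_(x in X) (sin (v x))%:E + \int[Pm]_(x in X) (cos (v x))%:E)%E.

End roc.

(* Main.v *)
(* By Cauchy-Schwarz, [a sin v + b cos v <= sqrt (a^2 + b^2)], with equality at
   [v = atan (a / b)]. Applied under the integral over X with [a = p_+] and
   [b = p_-], this shows that [v*] maximizes the objective. For an angle that
   factors through the score, [v = u o t], the objective is the integral of
   [sin u * f_+ + cos u * f_-] over the line, hence at most the arc length, with
   equality for [u = atan (f_+ / f_-)]. The optimal [v* = atan (p_+ / p_-)] does
   factor through [t = gamma (p_+ / p_-)], as [gamma] is strictly increasing, so
   both maxima coincide. *)
From HB Require Import structures.
Require Import Defs.
From mathcomp Require Import all_boot all_order all_algebra.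
From mathcomp Require Import all_classical all_reals all_analysis.
From mathcomp Require Import measurable_realfun.
From mathcomp Require Import ring lra.
Import Order.TTheory GRing.Theory Num.Theory.
Import numFieldNormedType.Exports.
Local Open Scope classical_set_scope.
Local Open Scope ring_scope.

(** * Pointwise trigonometric bounds *)

Lemma sin_cos_le_sqrt (R : realType) (a b x : R) :
  sin x * a + cos x * b <= Num.sqrt (a ^+ 2 + b ^+ 2).
Proof.
have [c0|c0] := leP 0 (sin x * a + cos x * b); last first.
  by rewrite (le_trans (ltW c0))// sqrtr_ge0.
rewrite -(ger0_norm c0) -sqrtr_sqr ler_wsqrtr//.
have := cos2Dsin2 x; move: (sin x) (cos x) => s c sc.
(* Lagrange's identity, with [c ^+ 2 + s ^+ 2 = 1]: the square on the left of the goal falls short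
   by [(c * a - s * b) ^+ 2]. *)
have -> : (a ^+ 2 + b ^+ 2) = (s * a + c * b) ^+ 2 + (c * a - s * b) ^+ 2.
  by rewrite -[LHS]mul1r -sc; ring.
by rewrite lerDl sqr_ge0.
Qed.

(** With [r = tan x] and [a = r * b], both sides equal [b / cos x]. *)
Lemma sin_cos_atan_sqrt (R : realType) (a b : R) : 0 < b ->
  sin (atan (a / b)) * a + cos (atan (a / b)) * b
  = Num.sqrt (a ^+ 2 + b ^+ 2).
Proof.
move=> b0; set r := a / b; set x := atan r.
have c0 : 0 < cos x by apply: cos_gt0_pihalf; rewrite atan_gtNpi2 atan_ltpi2.
have sE : sin x = r * cos x.
  by rewrite -[r in RHS]atanK -/x /tan divfK// gt_eqF.
have aE : a = r * b by rewrite divfK// gt_eqF.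
have := cos2Dsin2 x; rewrite sE => c1.
have -> : r * cos x * a + cos x * b = b / cos x.
  apply: (mulIf (lt0r_neq0 c0)); rewrite divfK ?gt_eqF//.
  by rewrite -[RHS]mulr1 -c1 aE; ring.
rewrite -[LHS]ger0_norm; last by rewrite divr_ge0 ?ltW.
rewrite -sqrtr_sqr; congr Num.sqrt.
apply: (mulIf (lt0r_neq0 (exprn_gt0 2 c0))).
rewrite -exprMn divfK ?gt_eqF//.
by rewrite -[LHS]mulr1 -c1 aE; ring.
Qed.

Lemma atan_div_pihalf (R : realType) (a b : R) : 0 <= a -> 0 <= b ->
  0 <= atan (a / b) <= pi / 2.
Proof.
move=> a0 b0; rewrite (ltW (atan_ltpi2 _)) andbT -[leLHS]atan0.
by rewrite le_atan// divr_ge0.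
Qed.

Lemma sin_cos_pihalf_ge0 (R : realType) (x : R) : 0 <= x <= pi / 2 ->
  0 <= sin x /\ 0 <= cos x.
Proof.
have p0 := pi_gt0 R.
move=> /andP[x0 xp].
by split; [apply: sin_ge0_pi|apply: cos_ge0_pihalf]; apply/andP; split=> //; lra.
Qed.

(** * Densities and changes of measure *)

(** [f] and the Radon-Nikodym derivative of [nu] have equal integrals over every measurable subset
    of [D], so they agree [mu]-almost everywhere on [D]. *)
Lemma ge0_integral_density dT (T : measurableType dT) (R : realType)
    (nu : {finite_measure set T -> \bar R})
    (mu : {sigma_finite_measure set T -> \bar R}) (D : set T) (f g : T -> R) :
  measurable D -> measurable_fun D f -> (forall x, D x -> 0 <= f x) ->
  (forall A, measurable A ->
     nu A = (\int[mu]_(x in D `&` A) (f x)%:E)%E) ->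
  measurable_fun D g -> (forall x, D x -> 0 <= g x) ->
  (\int[nu]_(x in D) (g x)%:E = \int[mu]_(x in D) (g x * f x)%:E)%E.
Proof.
move=> mD mf f0 nuE mg g0.
have numu : nu `<< mu.
  apply/null_content_dominatesP => A mA muA0.
  rewrite nuE// null_set_integral//.
  - exact: measurableI.
  - by apply/measurable_EFinP; apply: measurable_funS mf.
  - exact: (subset_measure0 (measurableI _ _ mD mA) mA).
(* [g] is nonnegative only on [D]; its extension by 0 is nonnegative everywhere, as the change of
   variables requires. *)
have -> : (\int[nu]_(x in D) (g x)%:E = \int[nu]_(x in D) ((g \_ D) x)%:E)%E.
  by apply: eq_integral => x xD; rewrite patchE xD.
have gD0 x : 0 <= (g \_ D) x.
  by rewrite patchE; case: ifPn => // /set_mem /g0.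
have mgD : measurable_fun D (g \_ D).
  by apply/measurable_restrict => //; rewrite setIid.
rewrite -(Radon_Nikodym_SigmaFinite.change_of_variables numu)//; last first.
  exact/measurable_EFinP.
set h := Radon_Nikodym_SigmaFinite.f nu mu.
have ih : mu.-integrable D h.
  apply: (integrableS measurableT) => //.
  exact: Radon_Nikodym_SigmaFinite.f_integrable.
have mh := measurable_int _ ih.
have ae : ae_eq mu D h (EFin \o f).
  apply: integral_ae_eq => //; first exact/measurable_EFinP.
  move=> E ED mE; rewrite -Radon_Nikodym_SigmaFinite.f_integral// nuE//.
  by rewrite (setIidr ED).
apply: ge0_ae_eq_integral => //.
- by apply: emeasurable_funM => //; exact/measurable_EFinP.
- by apply/measurable_EFinP; exact: measurable_funM.
- move=> x _; apply: mule_ge0; first by rewrite lee_fin.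
  exact: Radon_Nikodym_SigmaFinite.f_ge0.
- by move=> x Dx; rewrite lee_fin mulr_ge0 ?g0 ?f0.
- apply: filterS ae => x hf Dx; rewrite (hf Dx)/= EFinM.
  by rewrite patchE mem_set.
Qed.

(** Each half-open interval is a difference of two closed rays. Rays are the sets on which a CDF
    determines a measure. *)
Lemma measurable_itvNyc_generate (R : realType) :
  (@measurable _ (measurableTypeR R)) =
  <<s [set A | exists s : R, A = `]-oo, s]%classic ] >>.
Proof.
apply/seteqP; split.
  apply: smallest_sub; first exact: smallest_sigma_algebra.
  move=> _ [[a b] _ <-] /=.
  have -> : `]a, b]%classic = `]-oo, b]%classic `\` `]-oo, a]%classic :> set R.
    apply/seteqP; split => x /=; rewrite !in_itv/=.
      by move=> /andP[ax xb]; split=> //; apply/negP; rewrite -ltNge.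
    by move=> [xb /negP]; rewrite -ltNge => ->.
  by apply: (@measurableD _
      (g_sigma_algebraType [set A | exists s : R, A = `]-oo, s]%classic ]));
    apply: sub_sigma_algebra; eexists; reflexivity.
apply: smallest_sub; first exact: sigma_algebra_measurable.
by move=> _ [s ->]; exact: measurable_itv.
Qed.

(** Integrating [f] defines a measure that agrees with [nu] on the rays. These are stable under
    intersection, generate the Borel sets, and exhaust the line by sets of finite mass, so the two
    measures coincide. *)
Lemma cdf_density_measure (R : realType)
    (nu : {finite_measure set (measurableTypeR R) -> \bar R}) (f : R -> R) :
  has_cdf_density (fun s => nu `]-oo, s]%classic) f ->
  forall A, measurable A -> nu A = (\int[lebesgue_measure]_(s in A) (f s)%:E)%E.
Proof.
move=> [mf f0 nuE].
pose m (A : set (measurableTypeR R)) :=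
  (\int[@lebesgue_measure R]_(s in A) (f s)%:E)%E.
have m0 : m set0 = 0%E by rewrite /m integral_set0.
have m_ge0 A : (0 <= m A)%E by apply: integral_ge0 => x _; rewrite lee_fin.
have ma : semi_sigma_additive m.
  by apply: semi_sigma_additive_nng_induced => //; exact/measurable_EFinP.
pose M : {measure set (measurableTypeR R) -> \bar R} :=
  HB.pack m (isMeasure.Build _ _ _ m m0 m_ge0 ma).
refine (@measure_unique _ R (measurableTypeR R) _
  (fun n => `]-oo, n%:R]%classic : set R)
  (measurable_itvNyc_generate R) _ _ _ nu M _ _).
- move=> _ _ [a ->] [b ->]; exists (Num.min a b).
  apply/seteqP; split => x /=; rewrite !in_itv/= le_min.
    by case=> -> ->.
  by case/andP.
- by move=> n; exists n%:R.
- apply/seteqP; split => // x _; exists (Num.truncn `|x|).+1 => //=.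
  rewrite in_itv/=; apply/ltW/(le_lt_trans (ler_norm _)).
  exact: Num.Theory.truncnS_gt.
- by move=> _ [s ->]; exact: nuE.
- by move=> k; rewrite ltey_eq fin_num_measure//; exact: measurable_itv.
Qed.

(** * The objective as an integral over [X] and over the line of scores *)

Section optimal_roc.
Context {R : realType} {d : nat} {X : set (euclid R d)} (mX : measurable X).

Lemma density_prob_in (P : probability (euclid R d) R) (p : euclid R d -> R)
    (A : set (euclid R d)) :
  has_density X P p -> measurable A -> P A = P (X `&` A).
Proof.
move=> [mp p0 PE] mA.
by rewrite !PE//; [rewrite setIA setIid|exact: measurableI].
Qed.

(** The law of the score has [score_cdf] as its CDF, hence density [f]; integrating [g] against this
    law is integrating [g \o t] against [P]. *)
Lemma ge0_integral_score_density (P : probability (euclid R d) R)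
    (p t : euclid R d -> R) (f g : R -> R) :
  has_density X P p -> measurable_fun X t ->
  has_cdf_density (score_cdf X P t) f ->
  measurable_fun setT g -> (forall s, 0 <= g s) ->
  (\int[P]_(x in X) (g (t x))%:E =
   \int[lebesgue_measure]_s (g s * f s)%:E)%E.
Proof.
move=> Pp mt tf mg g0; have [mf f0 tfE] := tf.
(* A random variable must be defined on the whole space, so [t] is extended by 0. The complement of
   [X] is [P]-null, so this changes neither the CDF nor the integral. *)
have mtX : measurable_fun setT (t \_ X).
  exact: (proj1 (measurable_restrictT t mX) mt).
pose T : {mfun euclid R d >-> measurableTypeR R} :=
  HB.pack (t \_ X : euclid R d -> measurableTypeR R)
    (isMeasurableFun.Build _ _ _ _
       (t \_ X : euclid R d -> measurableTypeR R) mtX).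
have QE s : distribution P T `]-oo, s]%classic = score_cdf X P t s.
  rewrite /score_cdf /distribution /pushforward (density_prob_in P p)//.
    congr (P _); apply/seteqP; split => x /= [Xx];
    by rewrite /= patchE mem_set// in_itv.
  by rewrite -[X in measurable X]setTI; exact: (mtX measurableT _ (measurable_itv _)).
have Qf : has_cdf_density (fun s => distribution P T `]-oo, s]%classic) f.
  by split=> // s; rewrite QE.
have fE := cdf_density_measure _ _ _ Qf.
rewrite -(ge0_integral_density _ _ _ (distribution P T) lebesgue_measure setT)//;
  last by move=> A mA; rewrite setTI fE.
rewrite ge0_integral_distribution//; last exact/measurable_EFinP.
have PXC : P (~` X) = 0%E.
  rewrite (density_prob_in P p)//; last exact: measurableC.
  by rewrite setICr measure0.
have mgT : measurable_fun setT (EFin \o g \o T).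
  by apply/measurable_EFinP/measurableT_comp.
rewrite [RHS](ge0_negligible_integral (measurableC mX) measurableT mgT _ PXC)//.
  rewrite setTD setCK; apply: eq_integral => x xX.
  by rewrite /= patchE xX.
by move=> x _; rewrite lee_fin g0.
Qed.

Lemma measurable_fun_sin D : measurable_fun D (@sin R).
Proof.
apply: measurable_funTS; apply: continuous_measurable_fun.
exact: continuous_sin.
Qed.

Lemma measurable_fun_cos D : measurable_fun D (@cos R).
Proof.
apply: measurable_funTS; apply: continuous_measurable_fun.
exact: continuous_cos.
Qed.

(** Under a single Lebesgue integral, two angle functions can be compared point by point on [X]. *)
Lemma angle_objective_density (Pp Pm : probability (euclid R d) R)
    (pp pm v : euclid R d -> R) :
  has_density X Pp pp -> has_density X Pm pm -> angle_function X v ->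
  angle_objective X Pp Pm v =
  (\int[lebesgue_euclid d]_(x in X)
     (sin (v x) * pp x + cos (v x) * pm x)%:E)%E.
Proof.
move=> [mp p0 pE] [mm m0 mE] [mv v0].
have s0 x : X x -> 0 <= sin (v x) by move=> /v0 /sin_cos_pihalf_ge0[].
have c0 x : X x -> 0 <= cos (v x) by move=> /v0 /sin_cos_pihalf_ge0[].
have ms : measurable_fun X (sin \o v).
  by apply: measurableT_comp => //; exact: measurable_fun_sin.
have mc : measurable_fun X (cos \o v).
  by apply: measurableT_comp => //; exact: measurable_fun_cos.
rewrite /angle_objective.
rewrite (ge0_integral_density _ _ _ Pp (lebesgue_euclid d) X pp)//.
rewrite (ge0_integral_density _ _ _ Pm (lebesgue_euclid d) X pm)//.
under [RHS]eq_integral do rewrite EFinD.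
rewrite ge0_integralD//.
- by move=> x Xx; rewrite lee_fin mulr_ge0 ?s0 ?p0.
- by apply/measurable_EFinP; exact: measurable_funM.
- by move=> x Xx; rewrite lee_fin mulr_ge0 ?c0 ?m0.
- by apply/measurable_EFinP; exact: measurable_funM.
Qed.

Lemma angle_objective_score (Pp Pm : probability (euclid R d) R)
    (pp pm t : euclid R d -> R) (fp fm u : R -> R) :
  has_density X Pp pp -> has_density X Pm pm -> measurable_fun X t ->
  has_cdf_density (score_cdf X Pp t) fp ->
  has_cdf_density (score_cdf X Pm t) fm ->
  measurable_fun setT u -> (forall s, 0 <= u s <= pi / 2) ->
  angle_objective X Pp Pm (u \o t) =
  (\int[lebesgue_measure]_s (sin (u s) * fp s + cos (u s) * fm s)%:E)%E.
Proof.
move=> Ppd Pmd mt tp tm mu u0.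
have s0 s : 0 <= sin (u s) by have [] := sin_cos_pihalf_ge0 _ _ (u0 s).
have c0 s : 0 <= cos (u s) by have [] := sin_cos_pihalf_ge0 _ _ (u0 s).
have ms : measurable_fun setT (sin \o u).
  by apply: measurableT_comp => //; exact: measurable_fun_sin.
have mc : measurable_fun setT (cos \o u).
  by apply: measurableT_comp => //; exact: measurable_fun_cos.
rewrite /angle_objective.
rewrite (ge0_integral_score_density _ pp t fp (sin \o u))//.
rewrite (ge0_integral_score_density _ pm t fm (cos \o u))//.
have [mfp fp0 _] := tp; have [mfm fm0 _] := tm.
under [RHS]eq_integral do rewrite EFinD.
rewrite ge0_integralD//.
- by move=> x _; rewrite lee_fin mulr_ge0.
- by apply/measurable_EFinP; exact: measurable_funM.
- by move=> x _; rewrite lee_fin mulr_ge0.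
- by apply/measurable_EFinP; exact: measurable_funM.
Qed.

End optimal_roc.

(* A left inverse of [gamma] can be infinite above its range; after [atan] it
   is bounded, so that it extends to a monotone function on the whole line. *)
Lemma atan_increasing_factor (R : realType) (gamma : R -> R) :
  {in Num.nneg &, {homo gamma : x y / x < y}} ->
  exists u : R -> R, [/\ nondecreasing_fun u, forall s, 0 <= u s <= pi / 2
    & forall x, 0 <= x -> u (gamma x) = atan x].
Proof.
move=> ginc.
(* [u s] will be the supremum of [atan x] over [x >= 0] with [gamma x <= s]. The extra point 0 keeps
   the set nonempty when no such [x] exists. *)
pose A s := [set y : R |
  y = 0 \/ exists x, [/\ 0 <= x, gamma x <= s & y = atan x]].
have A0 s : A s 0 by left.
have Apos s y : A s y -> 0 <= y <= pi / 2.
  case=> [->|[x [x0 _ ->]]]; first by rewrite lexx divr_ge0 ?pi_ge0.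
  by have := atan_div_pihalf _ x 1 x0 ler01; rewrite divr1.
have Aub s : has_ubound (A s) by exists (pi / 2) => y /Apos/andP[].
have A1 s : A s !=set0 by exists 0.
exists (fun s => sup (A s)); split.
- move=> s t st; apply: ge_sup => // y Ay; apply: ub_le_sup => //.
  case: Ay => [->|[x [x0 xs ->]]]; first by left.
  by right; exists x; split=> //; exact: le_trans st.
- move=> s; rewrite ub_le_sup//=; apply: ge_sup => // y.
  by move=> /Apos/andP[].
- move=> x x0; apply/eqP; rewrite eq_le; apply/andP; split; last first.
    by apply: ub_le_sup => //; right; exists x.
  apply: ge_sup => // y [->|[z [z0 zx ->]]].
    by rewrite -[leLHS]atan0 le_atan.
  apply: le_atan; rewrite leNgt; apply/negP => xz.
  by have := ginc _ _ x0 z0 xz; rewrite ltNge zx.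
Qed.

Theorem mainTheorem2 (R : realType) (d : nat) (X : set (euclid R d))
    (pp pm : euclid R d -> R) (Pp Pm : probability (euclid R d) R)
    (gamma : R -> R) (J : set R) (fp fm : R -> R)
    (mX : measurable X)
    (Pp_dens : has_density X Pp pp) (Pm_dens : has_density X Pm pm)
    (pm_gt0 : forall x, X x -> 0 < pm x)
    (gamma_inc : {in Num.nneg &, {homo gamma : x y / x < y}})
    (t_reg : regular_score X Pp Pm (optimal_score gamma pp pm) J fp fm) :
  let vstar := fun x => atan (pp x / pm x) in
  let S := [set angle_objective X Pp Pm v | v in angle_function X] in
  [/\ roc_arc_length fp fm = ereal_sup S,
      angle_function X vstar
    & angle_objective X Pp Pm vstar = ereal_sup S].
Proof.
move=> vstar S.
have [mt _ _ _ _ tp tm fm_gt0 f_out] := t_reg.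
set t := optimal_score gamma pp pm in mt tp tm.
have [mp p0 _] := Pp_dens; have [mm m0 _] := Pm_dens.
have [mfp fp0 _] := tp; have [mfm fm0 _] := tm.
have [u [u_nd u_itv uE]] := atan_increasing_factor _ gamma gamma_inc.
have mu : measurable_fun setT u by exact: nondecreasing_measurable.
have angle_score (w : R -> R) : measurable_fun setT w -> (forall s, 0 <= w s <= pi / 2) ->
    angle_function X (w \o t).
  by move=> mw w0; split=> [|x _ /=]; [exact: measurableT_comp|exact: w0].
have vstarE x : X x -> vstar x = u (t x).
  move=> Xx; rewrite /t /optimal_score uE//.
  by rewrite divr_ge0 ?p0 ?m0.
have vstar_angle : angle_function X vstar.
  (* Measurability of [vstar] comes from the score: on [X] it equals [u \o t] with [u] monotone. *)
  have [mut ut_itv] := angle_score u mu u_itv; split=> [|x Xx]; last first.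
    by rewrite vstarE//; exact: ut_itv.
  apply: eq_measurable_fun mut => x /set_mem Xx.
  by rewrite vstarE.
have vstar_max : angle_objective X Pp Pm vstar = ereal_sup S.
  apply/eqP; rewrite eq_le; apply/andP; split.
    by apply: ereal_sup_ubound; exists vstar.
  apply: ub_ereal_sup => _ [v v_angle <-].
  rewrite !(angle_objective_density mX _ _ pp pm)//.
  have mobj w : angle_function X w -> measurable_fun X
      (fun x => (sin (w x) * pp x + cos (w x) * pm x)%:E).
    move=> [mw _]; apply/measurable_EFinP; apply: measurable_funD;
      apply: measurable_funM => //; apply: measurableT_comp => //;
      [exact: measurable_fun_sin|exact: measurable_fun_cos].
  apply: ge0_le_integral => //; [|exact: mobj|exact: mobj|].
    move=> x Xx; have [_ /(_ x Xx)/sin_cos_pihalf_ge0[s0 c0]] := v_angle.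
    by rewrite lee_fin addr_ge0// mulr_ge0 ?p0 ?m0.
  move=> x Xx; rewrite lee_fin sin_cos_atan_sqrt ?pm_gt0//.
  exact: sin_cos_le_sqrt.
split=> //; apply/eqP; rewrite eq_le; apply/andP; split.
  (* The maximizing angle on the line of scores. Where [fm s = 0] the quotient is 0 by convention,
     so [w s = 0] is still admissible. *)
  pose w s := atan (fp s / fm s).
  have w_itv s : 0 <= w s <= pi / 2 by exact: atan_div_pihalf.
  have mw : measurable_fun setT w.
    (* Writing the inverse as a real power, valid since [fm s >= 0] and also at 0, reduces
       measurability to that of [powR]. *)
    rewrite (_ : w = fun s => atan (fp s * powR (fm s) (-1))); last first.
      by apply/funext => s; rewrite powR_inv1.
    apply: (@measurableT_comp _ _ _ _ _ _ (@atan R)).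
      apply: continuous_measurable_fun => x; exact: continuous_atan.
    apply: measurable_funM => //.
    exact: (measurableT_comp (measurable_powR (-1)) mfm).
  rewrite [leLHS](_ : _ = angle_objective X Pp Pm (w \o t)); last first.
    rewrite (angle_objective_score mX _ _ pp pm t fp fm)//.
    apply: eq_integral => s _; congr EFin.
    (* On [J] the positivity of [fm] gives equality in Cauchy-Schwarz; off [J] both densities vanish
       and both sides are 0. *)
    have [Js|NJs] := pselect (J s); first by rewrite sin_cos_atan_sqrt ?fm_gt0.
    have [-> ->] := f_out s NJs.
    by rewrite !mulr0 expr0n addr0 sqrtr0.
  by apply: ereal_sup_ubound; exists (w \o t) => //; exact: angle_score.
(* Conversely, replacing [vstar] by [u \o t] moves the maximum to the line, where its integrand is
   bounded by that of the arc length. *)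
rewrite -vstar_max [leLHS](_ : _ = angle_objective X Pp Pm (u \o t)); last first.
  by rewrite /angle_objective; congr (_ + _)%E; apply: eq_integral => x /set_mem Xx;
    rewrite /= vstarE.
rewrite (angle_objective_score mX _ _ pp pm t fp fm)//.
apply: ge0_le_integral => //.
- move=> s _; have [s0 c0] := sin_cos_pihalf_ge0 _ _ (u_itv s).
  by rewrite lee_fin addr_ge0// mulr_ge0.
- apply/measurable_EFinP; apply: measurable_funD;
    apply: measurable_funM => //; apply: measurableT_comp => //;
    [exact: measurable_fun_sin|exact: measurable_fun_cos].
- apply/measurable_EFinP.
  apply: (@measurableT_comp _ _ _ _ _ _ (@Num.sqrt R)).
    apply: continuous_measurable_fun => x; exact: sqrt_continuous.
  by apply: measurable_funD; exact: measurable_funX.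
- by move=> s _; rewrite lee_fin sin_cos_le_sqrt.
Qed.
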